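(* Let $r$ be an integer with $0\le r\le \underline{\kappa}_0+1$. Let $$\underline{C}_0^r=\sup_{0\neq\varphi\in\mathbb{P}^{\underline{\kappa}_0+1}_{\max}[\Omega]}\ \inf_{\varphi_h\in\mathcal{S}[p;\mathcal{M}^0_\ast]}\frac{|\varphi-\varphi_h|_{\mathcal{H}^r(\Omega;\mathcal{M}^0_\ast)}}{\|\varphi\|_{H^{p+1}(\Omega)}}$$ and let $\varphi^{r,\ast}\in\mathbb{P}^{\underline{\kappa}_0+1}_{\max}[\Omega]$ be a function with $\|\varphi^{r,\ast}\|_{H^{p+1}(\Omega)}=1$ attaining this supremum, i.e. $\inf_{\varphi_h\in\mathcal{S}[p;\mathcal{M}^0_\ast]}|\varphi^{r,\ast}-\varphi_h|_{\mathcal{H}^r(\Omega;\mathcal{M}^0_\ast)}=\underline{C}_0^r$. Let $\underline{c}^r$ be a constant such that for all integers $\ell\ge 0$ $$\inf_{\varphi_h\in\mathcal{S}[p;\mathcal{M}^\ell_0]}|\varphi^{r,\ast}-\varphi_h|_{\mathcal{H}^r(\Omega^0;\mathcal{M}^\ell_0)}\ \ge\ \underline{c}^r\left(\frac{1}{2^\ell}\right)^{p+1-r}\underline{C}_0^r .$$ Then for all integers $\ell\ge 0$ $$\inf_{\varphi_h\in\mathcal{S}[p;\mathcal{M}^\ell_\ast]}|\varphi^{r,\ast}-\varphi_h|_{\mathcal{H}^r(\Omega;\mathcal{M}^\ell_\ast)}\ \ge\ \min(1,\underline{c}^r)\,\underline{C}_0^r\left(\sum_{i=0}^{\ell}A^{2i}B^{2(\ell-i)}\right)^{1/2},$$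 where $A=\lambda^{\underline{\kappa}_0+2-r}$ and $B=1/2^{p+1-r}$.
   Context: Domain. $\Omega\subset\mathbb{R}^2$ is an open domain containing the origin with $\overline{\Omega}=\bigcup_{i=0}^\infty\overline{\Omega^i}$, where the $\Omega^i$ are open, pairwise disjoint, ring-shaped subdomains around the origin. Each ring $\Omega^i$ is composed of $N$ (pairwise disjoint, open) elements $\omega^i_1,\dots,\omega^i_N$, i.e. $\overline{\Omega^i}=\bigcup_n\overline{\omega^i_n}$, with $C^\infty$-smooth, regular parameterizations $\mathbf{G}^i_n:B\to\omega^i_n$, $B=\,]0,1[^2$ (regular: bijective onto $\omega^i_n$, smooth and with nonvanishing Jacobian determinant up to the boundary of $B$). There is a fixed $\lambda\in\,]0,1[$ with $\mathbf{G}^i_n=\lambda^i\,\mathbf{G}^0_n$ for all $i,n$; consequently $\Omega^{i+1}=\lambda\Omega^i$. All $\mathbf{G}^i_n$ are polynomial mappings, $\mathbf{G}^i_n\in(\mathbb{Q}^q)^2$ for some degree $q$. Here $\mathbb{Q}^k$ denotes polynomials of degree at most $k$ in each variable and $\mathbb{P}^k$ polynomials of total degree at most $k$ (with $[D]$ denoting the domain $D$). Meshes. For an integer $k\ge0$, $\widehat{\mathcal{M}}^k$ is the set of the $4^k$ open squares $]j_1/2^k,(j_1+1)/2^k[\times]j_2/2^k,(j_2+1)/2^k[$, $0\le j_1,j_2\le 2^k-1$. For $0\le i\le\ell$: $\mathcal{M}^\ell_{i,n}=\{\mathbf{G}^i_n(b):b\in\widehat{\mathcal{M}}^{\ell-i}\}$,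 $\mathcal{M}^\ell_i=\bigcup_{n=1}^N\mathcal{M}^\ell_{i,n}$ (a mesh on $\Omega^i$), $\mathcal{M}^\ell=\bigcup_{i=0}^\ell\mathcal{M}^\ell_i$. The cap is the single element $\omega^{\ell+1}_\ast=\mathrm{int}\big(\bigcup_{i\ge\ell+1}\overline{\Omega^i}\big)=\lambda^{\ell+1}\Omega$, and $\mathcal{M}^\ell_\ast=\mathcal{M}^\ell\cup\{\omega^{\ell+1}_\ast\}$. Discrete spaces. $p$ is a fixed degree. For $\omega\in\mathcal{M}^\ell_{i,n}$, $\mathcal{S}[p;\omega]=\{\varphi:\omega\to\mathbb{R}:\varphi\circ\mathbf{G}^i_n\in\mathbb{Q}^p\}$ (composition on the sub-square $b$ with $\omega=\mathbf{G}^i_n(b)$). On the cap, $\mathcal{S}[p;\omega^{\ell+1}_\ast]$ is a suitable finite-dimensional function space (contained in $H^r(\omega^{\ell+1}_\ast)$), and these cap spaces are scaled copies of each other: $\mathcal{S}[p;\omega^{\ell+1}_\ast]=\{\psi(\lambda^{-\ell}\,\cdot\,):\psi\in\mathcal{S}[p;\omega^1_\ast]\}$. For a subset $\Theta\subseteq\mathcal{M}^\ell_\ast$ covering $\theta$ (i.e. $\overline\theta=\bigcup_{\omega\in\Theta}\overline\omega$), $\mathcal{S}[p;\Theta]=\{\varphi\in L^2(\theta):\varphi|_\omega\in\mathcal{S}[p;\omega]\ \forall\omega\in\Theta\}$ (no interelement continuity). Norms. $|\cdot|_{H^r(\omega)}$ is the standard Sobolev seminorm, $|\varphi|^2_{H^r(\omega)}=\int_\omega\sum_{\alpha_x+\alpha_y=r}(\partial_x^{\alpha_x}\partial_y^{\alpha_y}\varphi)^2$,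 and the broken seminorm is $|\varphi|^2_{\mathcal{H}^r(\theta;\Theta)}=\sum_{\omega\in\Theta}|\varphi|^2_{H^r(\omega)}$. Reproduction degree. $\kappa[\omega]$ is the largest integer with $\mathbb{P}^{\kappa[\omega]}[\omega]\subseteq\mathcal{S}[p;\omega]$. Set $\underline{\kappa}_0=\min_{\omega\in\mathcal{M}^0}\kappa[\omega]$ (the cap is not included in $\mathcal{M}^0$), and assume $\kappa[\omega^1_\ast]\ge\underline{\kappa}_0$. Finally $\mathbb{P}^{\underline{\kappa}_0+1}_{\max}[\Omega]=\mathrm{span}\{x^{\underline{\kappa}_0+1},x^{\underline{\kappa}_0}y,\dots,y^{\underline{\kappa}_0+1}\}$. *)

(* Defs.v *)
(* MathComp-Analysis.  The plane is [R * R] for [R : realType], with the product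
   topology and the product of the one-dimensional Lebesgue measures.  Functions
   on a subset of the plane are total functions [R * R -> R]; every notion below
   that refers to a subset depends only on the values taken on that subset. *)
From HB Require Import structures.
From mathcomp Require Import all_boot all_order all_algebra.
From mathcomp Require Import all_classical all_reals all_analysis.

Set Implicit Arguments.
Unset Strict Implicit.
Unset Printing Implicit Defensive.

Import Order.TTheory GRing.Theory Num.Theory.
Import numFieldNormedType.Exports.

Local Open Scope classical_set_scope.
Local Open Scope ring_scope.

Section Sobolev.
Variable R : realType.
Local Notation plane := (R * R)%type.
Implicit Types (w : set plane) (u g psi : plane -> R).

Definition leb2 : set plane -> \bar R :=
  ((@lebesgue_measure R) \x (@lebesgue_measure R))%E.

(* d^a/dx^a d^b/dy^b, pointwise *)
Definition partial (a b : nat) u : plane -> R :=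
  iter a (fun f : plane -> R => 'D_((1, 0) : plane) f)
    (iter b (fun f : plane -> R => 'D_((0, 1) : plane) f) u).

Definition smooth u : Prop :=
  forall s : seq plane,
    let f := foldr (fun (v : plane) (f : plane -> R) => 'D_v f) u s in
    forall x : plane, differentiable f x.

Definition test_function w psi : Prop :=
  smooth psi /\
  exists K : set plane,
    [/\ compact K, K `<=` w & forall x, ~ K x -> psi x = 0].

Definition loc_integrable w u : Prop :=
  measurable_fun w u /\
  forall K : set plane, K `<=` w -> compact K ->
    leb2.-integrable K (EFin \o u).

Definition is_weak_derivative w (a b : nat) u g : Prop :=
  [/\ loc_integrable w u, loc_integrable w g &
   forall psi, test_function w psi ->
     \int[leb2]_(x in w) (u x * partial a b psi x) =
     (-1) ^+ (a + b) * \int[leb2]_(x in w) (g x * psi x)].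

Definition L2 w u : Prop :=
  measurable_fun w u /\ (\int[leb2]_(x in w) (u x ^+ 2)%:E < +oo)%E.

Definition Hspace (r : nat) w u : Prop :=
  L2 w u /\
  forall a b : nat, (a + b <= r)%N ->
    exists2 g, is_weak_derivative w a b u g & L2 w g.

(* Squared L2 norm of the weak derivative.  Weak derivatives are unique up to
   null sets, so the infimum is over a set with at most one element; it is +oo
   when there is no weak derivative. *)
Definition weak_derivative_sq w (a b : nat) u : \bar R :=
  ereal_inf [set (\int[leb2]_(x in w) (g x ^+ 2)%:E)%E
            | g in [set g | is_weak_derivative w a b u g]].

Definition Hseminorm_sq (r : nat) w u : \bar R :=
  (\sum_(a < r.+1) weak_derivative_sq w a (r - a)%N u)%E.

Definition Hnorm (m : nat) w u : \bar R :=
  sqrte (\sum_(s < m.+1) Hseminorm_sq s w u)%E.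

End Sobolev.

Section Polynomials.
Variable R : realType.
Implicit Types f : R * R -> R.

Definition Qpoly (k : nat) f : Prop :=
  exists c : nat -> nat -> R, forall x,
    f x = \sum_(i < k.+1) \sum_(j < k.+1) c i j * x.1 ^+ i * x.2 ^+ j.

Definition Ppoly (k : nat) f : Prop :=
  exists c : nat -> nat -> R, forall x,
    f x = \sum_(i < k.+1) \sum_(j < k.+1 | (i + j <= k)%N)
            c i j * x.1 ^+ i * x.2 ^+ j.

Definition Pmax (k : nat) f : Prop :=
  exists c : nat -> R, forall x,
    f x = \sum_(i < k.+1) c i * x.1 ^+ (k - i) * x.2 ^+ i.

End Polynomials.

Section Geometry.
Variable R : realType.
Local Notation plane := (R * R)%type.

Definition dilate (t : R) (x : plane) : plane := (t * x.1, t * x.2).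

Definition unit_square : set plane :=
  [set x | (0 < x.1 < 1) && (0 < x.2 < 1)].

Definition closed_unit_square : set plane :=
  [set x | (0 <= x.1 <= 1) && (0 <= x.2 <= 1)].

Definition jacobian (G : plane -> plane) (x : plane) : R :=
  'D_((1, 0) : plane) (fun y => (G y).1) x *
  'D_((0, 1) : plane) (fun y => (G y).2) x -
  'D_((0, 1) : plane) (fun y => (G y).1) x *
  'D_((1, 0) : plane) (fun y => (G y).2) x.

Definition annulus : set plane :=
  [set x | 1 < x.1 ^+ 2 + x.2 ^+ 2 < 4].

(* Homeomorphic to an open annulus, staying away from the origin and having the
   origin in its hole. *)
Definition ring_shaped (D : set plane) : Prop :=
  [/\ exists f g : plane -> plane,
        [/\ {within annulus, continuous f}, {within D, continuous g},
            set_bij annulus D f & forall x, annulus x -> g (f x) = x],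
      ~ closure D (0 : plane) &
      bounded_set (connected_component (~` D) (0 : plane))].

(* The parameterizations are polynomial on the whole plane, which makes them
   smooth up to the boundary of the unit square.  The union of the closures of
   the rings misses the origin, hence the outer closures in [rd_cover] and
   [rd_cap]. *)
Record ringDomain := RingDomain {
  rd_N : nat;
  rd_q : nat;
  rd_lambda : R;
  rd_Omega : set plane;
  rd_ring : nat -> set plane;
  rd_elt : nat -> 'I_rd_N -> set plane;
  rd_G : nat -> 'I_rd_N -> plane -> plane;
  rd_lambda01 : 0 < rd_lambda < 1;
  rd_Omega_open : open rd_Omega;
  rd_Omega_connected : connected rd_Omega;
  rd_Omega0 : rd_Omega 0;
  rd_ring_open : forall i, open (rd_ring i);
  rd_ring_sub : forall i, rd_ring i `<=` rd_Omega;
  rd_ring_disjoint : trivIset setT rd_ring;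
  rd_ring_shaped : forall i, ring_shaped (rd_ring i);
  rd_cover :
    closure rd_Omega = closure (\bigcup_(i in setT) closure (rd_ring i));
  rd_elt_open : forall i n, open (rd_elt i n);
  rd_elt_sub : forall i n, rd_elt i n `<=` rd_ring i;
  rd_elt_disjoint : forall i, trivIset setT (rd_elt i);
  rd_ring_cover : forall i,
    closure (rd_ring i) = \bigcup_(n in setT) closure (rd_elt i n);
  rd_G_bij : forall i n, set_bij unit_square (rd_elt i n) (rd_G i n);
  rd_G_poly : forall i n,
    Qpoly rd_q (fun x => (rd_G i n x).1) /\
    Qpoly rd_q (fun x => (rd_G i n x).2);
  rd_G_regular : forall i n x,
    closed_unit_square x -> jacobian (rd_G i n) x != 0;
  rd_G_scaled : forall i n x,
    rd_G i n x = dilate (rd_lambda ^+ i) (rd_G 0%N n x);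
  rd_ring_scaled : forall i,
    rd_ring i.+1 = dilate rd_lambda @` rd_ring i;
  rd_cap : forall l,
    interior (closure (\bigcup_(i in [set i | (l.+1 <= i)%N])
                         closure (rd_ring i))) =
    dilate (rd_lambda ^+ l.+1) @` rd_Omega
}.

End Geometry.

Section Discretization.
Variables (R : realType) (D : ringDomain R) (p : nat).
Local Notation plane := (R * R)%type.
Local Notation N := (rd_N D).
Implicit Types (phi : plane -> R) (theta : set plane).

(* [cap l] is the domain written omega_*^(l+1). *)
Definition cap (l : nat) : set plane :=
  dilate (rd_lambda D ^+ l.+1) @` rd_Omega D.

Definition dyadic_square (k j1 j2 : nat) : set plane :=
  [set x | (j1%:R / 2 ^+ k < x.1 < j1.+1%:R / 2 ^+ k) &&
           (j2%:R / 2 ^+ k < x.2 < j2.+1%:R / 2 ^+ k)].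

(* [Cell i n k j1 j2] is the image under G^i_n of the dyadic square (j1, j2) of
   level k; [Cap l] is [cap l]. *)
Inductive element :=
| Cell of nat & 'I_N & nat & nat & nat
| Cap of nat.

HB.instance Definition _ := gen_eqMixin element.

Definition element_dom (e : element) : set plane :=
  match e with
  | Cell i n k j1 j2 => rd_G i n @` dyadic_square k j1 j2
  | Cap l => cap l
  end.

Definition mesh_patch (l i : nat) (n : 'I_N) : seq element :=
  [seq Cell i n (l - i) j1 j2
    | j1 <- iota 0 (2 ^ (l - i)), j2 <- iota 0 (2 ^ (l - i))].

Definition mesh_ring (l i : nat) : seq element :=
  flatten [seq mesh_patch l i n | n <- enum 'I_N].

Definition mesh (l : nat) : seq element :=
  flatten [seq mesh_ring l i | i <- iota 0 l.+1].

Definition mesh_star (l : nat) : seq element := rcons (mesh l) (Cap l).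

Definition finite_dim_space (w : set plane) (V : set (plane -> R)) : Prop :=
  exists (m : nat) (e : 'I_m -> plane -> R),
    V = [set phi | exists c : 'I_m -> R,
                     forall x, w x -> phi x = \sum_(j < m) c j * e j x].

(* [capS l] is the function space on [cap l]. *)
Variable capS : nat -> set (plane -> R).

Definition cap_spaces_scaled : Prop :=
  forall l, capS l =
    [set phi | exists2 psi, capS 0%N psi &
       forall x, cap l x -> phi x = psi (dilate (rd_lambda D ^- l) x)].

Definition element_space (e : element) : set (plane -> R) :=
  match e with
  | Cell i n k j1 j2 =>
      [set phi | exists2 f, Qpoly p f &
         forall x, dyadic_square k j1 j2 x -> phi (rd_G i n x) = f x]
  | Cap l => capS l
  end.

Definition discrete_space theta (Th : seq element) : set (plane -> R) :=
  [set phi | L2 theta phi /\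
     {in Th, forall e, element_space e phi}].

Definition broken_seminorm (r : nat) (Th : seq element) phi : \bar R :=
  sqrte (\sum_(e <- Th) Hseminorm_sq r (element_dom e) phi)%E.

Definition best_error (r : nat) theta (Th : seq element) phi : \bar R :=
  ereal_inf [set broken_seminorm r Th (phi \- phi_h)
            | phi_h in discrete_space theta Th].

Definition reproduces (e : element) (k : nat) : Prop :=
  forall f, Ppoly k f -> element_space e f.

Definition is_kappa (e : element) (k : nat) : Prop :=
  reproduces e k /\ forall m, reproduces e m -> (m <= k)%N.

Definition is_kappa0 (k0 : nat) : Prop :=
  (exists2 e, e \in mesh 0 & is_kappa e k0) /\
  forall e k, e \in mesh 0 -> is_kappa e k -> (k0 <= k)%N.

Definition C0 (k0 r : nat) : \bar R :=
  ereal_sup [set (best_error r (rd_Omega D) (mesh_star 0) phi /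
                  Hnorm p.+1 (rd_Omega D) phi)%E
            | phi in [set phi | Pmax k0.+1 phi /\ phi <> cst 0]].

End Discretization.

(* Main.v *)
Require Import Defs.
From HB Require Import structures.
From mathcomp Require Import all_boot all_order all_algebra.
From mathcomp Require Import all_classical all_reals all_analysis.
From mathcomp Require Import measurable_realfun.
From mathcomp Require Import ring.
Import Order.TTheory GRing.Theory Num.Theory.
Import numFieldNormedType.Exports.
Local Open Scope classical_set_scope.
Local Open Scope ring_scope.

Set Implicit Arguments.
Unset Strict Implicit.
Unset Printing Implicit Defensive.

(** The function [phi] is homogeneous of degree [kappa0 + 1], and the mesh, the
    discrete spaces and the domains are all transported by the dilation of
    ratio [lambda^i]: ring [0] with [k] refinements goes to ring [i] with [k]
    refinements at level [i + k], and the coarsest mesh of the whole of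
    [Omega], cap included, goes to the last ring and the cap of level [l].
    Rescaling a discrete function [u] to
    [v x = lambda^(-i (kappa0 + 1)) u (lambda^i x)] turns the error of [u] on
    ring [i] into the error of [v] on ring [0]; in the plane, derivatives of
    order [r] give the factor [A^(2 i)] between the squared seminorms.  As [v]
    is again discrete, the squared error of [u] at level [l] is at least
    - [A^(2 i)] times the squared best error on ring [0] with [l - i]
      refinements, for the rings [i < l]; the hypothesis on [c] bounds this
      below by [c^2 A^(2 i) B^(2 (l - i)) C0^2];
    - [A^(2 l)] times the squared best error of the coarsest mesh of [Omega],
      that is [A^(2 l) C0^2], for ring [l] and the cap together.
    Adding these contributions and taking the square root gives the bound when
    [c] is positive, and when [c <= 0] the left-hand side is nonpositive.  All
    inequalities hold between extended reals, so [C0] may be infinite.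

    The step that carries the argument is [best_error_shift].  It rests on the
    scaling of weak derivatives ([weak_derivative_dilate]), hence on a change
    of variables for dilations of the plane ([integral_comp_bij],
    [leb2_scale]), and on the inclusion of [lambda^l Omega] in [Omega]
    ([dilate_lamX_Omega]), which makes the rescaled function square integrable
    on [Omega]. *)

(** * Change of variables by a measurable bijection *)

Section ChangeOfVariables.
Context d (T : measurableType d) (R : realType).
Variable mu : {measure set T -> \bar R}.
Implicit Types (f : T -> \bar R) (D : set T).
Import HBNNSimple.

(** The integral of a nonnegative function, as the library defines it. *)
Definition lower_integral f : \bar R :=
  ereal_sup [set sintegral mu h |
    h in [set h : {nnsfun T >-> R} | forall x, ((h x)%:E <= f x)%E]].

Lemma integralE_lower D f :
  (\int[mu]_(x in D) f x =
   lower_integral ((f \_ D)^\+) - lower_integral ((f \_ D)^\-))%E.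
Proof. by []. Qed.

Lemma le_lower_integral f g :
  (forall x, f x <= g x)%E -> (lower_integral f <= lower_integral g)%E.
Proof.
move=> fg; apply: ge_ereal_sup => _ [h hf <-]; apply: ereal_sup_ubound.
by exists h => //= x; exact: le_trans (hf x) (fg x).
Qed.

(** Composing with [F] and scaling by [c] sends a simple function below [f] to
    one below the right-hand integrand. *)
Lemma lower_integral_comp_ge (F : T -> T) (k c : R) f :
  measurable_fun setT F -> 0 < k -> 0 < c ->
  (forall A, measurable A -> mu (F @^-1` A) = k%:E * mu A)%E ->
  ((c * k)%:E * lower_integral f <=
   lower_integral (fun x => c%:E * f (F x)))%E.
Proof.
move=> mF k0 c0 muF; rewrite -lee_pdivlMl ?mulr_gt0//.
apply: ge_ereal_sup => _ [h hf <-]; rewrite lee_pdivlMl ?mulr_gt0//.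
have mhF : measurable_fun setT (h \o F) by exact: measurableT_comp.
have fhF : finite_set (range (h \o F)).
  apply: sub_finite_set (@fimfunP _ _ h) => _ [x _ <-] /=.
  by exists (F x).
have hF0 : forall x, 0 <= (h \o F) x by move=> x /=; exact: fun_ge0.
pose hF : {nnsfun T >-> R} := HB.pack (h \o F)
  (isMeasurableFun.Build _ _ _ _ _ mhF) (FiniteImage.Build _ _ _ fhF)
  (isNonNegFun.Build _ _ _ hF0).
have shF : sintegral mu hF = (k%:E * sintegral mu h)%E.
  rewrite !sintegralET ge0_mule_fsumr; last exact: nnsfun_mulemu_ge0.
  apply: eq_fsbigr => x _; rewrite muleCA -muF//.
rewrite EFinM -muleA -shF -sintegralrM.
apply: ereal_sup_ubound; exists (scale_nnsfun hF (ltW c0)) => //= x.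
by rewrite /scale_nnsfun/= EFinM lee_pmul2l.
Qed.

(** The missing inequality is the previous lemma for the inverse bijection. *)
Lemma lower_integral_comp (F G : T -> T) (k c : R) f :
  measurable_fun setT F -> measurable_fun setT G ->
  cancel F G -> cancel G F -> 0 < k -> 0 < c ->
  (forall A, measurable A -> mu (F @^-1` A) = k%:E * mu A)%E ->
  (lower_integral (fun x => c%:E * f (F x)) = (c * k)%:E * lower_integral f)%E.
Proof.
move=> mF mG FG GF k0 c0 muF; apply/eqP.
rewrite eq_le lower_integral_comp_ge// andbT.
rewrite -lee_pdivrMl ?mulr_gt0//.
rewrite invfM; apply: le_trans (@lower_integral_comp_ge G _ _ _ _ _ _ _) _ => //.
- by rewrite invr_gt0.
- by rewrite invr_gt0.
- move=> A mA; rewrite -[A in RHS](_ : F @^-1` (G @^-1` A) = A); last first.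
    by apply/seteqP; split => x /=; rewrite FG.
  rewrite muF; last by rewrite -[_ @^-1` _]setTI; exact: mG.
  by rewrite muleA -EFinM mulVf ?mul1e// gt_eqF.
by apply: le_lower_integral => x; rewrite GF muleA -EFinM mulVf ?mul1e// gt_eqF.
Qed.

(** Neither [f] nor [D] has to be measurable: the integral is a supremum over
    simple functions, and [F] permutes those. *)
Lemma integral_comp_bij (F G : T -> T) (k c : R) D f :
  measurable_fun setT F -> measurable_fun setT G ->
  cancel F G -> cancel G F -> 0 < k -> 0 < c ->
  (forall A, measurable A -> mu (F @^-1` A) = k%:E * mu A)%E ->
  (\int[mu]_(x in F @^-1` D) (c%:E * f (F x)) =
   (c * k)%:E * \int[mu]_(x in D) f x)%E.
Proof.
move=> mF mG FG GF k0 c0 muF; rewrite !integralE_lower.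
have restrictE x : ((fun x => c%:E * f (F x)) \_ (F @^-1` D) x =
    c%:E * (f \_ D) (F x))%E.
  rewrite /patch; have [xD|xD] := boolP (x \in _).
    by move: xD; rewrite inE /= => xD; rewrite mem_set.
  by rewrite notin_setE /= in xD; rewrite memNset// mule0.
have -> : ((fun x => c%:E * f (F x)) \_ (F @^-1` D))^\+%E =
    (fun x => c%:E * (f \_ D)^\+ (F x))%E.
  apply/funext => x.
  by rewrite !funeposE restrictE -[X in maxe _ X](mule0 c%:E) -maxe_pMr//
    lee_fin ltW.
have -> : ((fun x => c%:E * f (F x)) \_ (F @^-1` D))^\-%E =
    (fun x => c%:E * (f \_ D)^\- (F x))%E.
  apply/funext => x; rewrite !funenegE restrictE -muleN.
  by rewrite -[X in maxe _ X](mule0 c%:E) -maxe_pMr ?lee_fin ?(ltW c0).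
rewrite !(lower_integral_comp _ mF mG FG GF k0 c0 muF).
have ck0 : 0 < c * k by rewrite mulr_gt0.
move: (lower_integral _) (lower_integral _) => [x| |] [y| |];
  by rewrite ?gt0_muley ?gt0_muleNy ?lte_fin// -?EFinN -?EFinM -?EFinD -?EFinM
    ?mulrBr.
Qed.

End ChangeOfVariables.

(** * Lebesgue measure under dilations of the plane *)

Section Dilations.
Variable R : realType.
Local Notation plane := (R * R)%type.
Implicit Types (t : R) (A : set plane).

(** The rescaled pushforward has the length of the interval on every interval,
    so uniqueness of the Lebesgue measure applies. *)
Lemma lebesgue_measure_scale t (X : set (measurableTypeR R)) : 0 < t ->
  measurable X ->
  (lebesgue_measure (( *%R t : R -> R) @^-1` X) =
   (t^-1)%:E * lebesgue_measure X)%E.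
Proof.
move=> t0 mX; have tge0 : 0 <= t by exact: ltW.
pose f : measurableTypeR R -> measurableTypeR R := *%R t.
have mf : measurable_fun [set: measurableTypeR R] f by exact: mulrl_measurable.
unshelve epose (m := pushforward (@lebesgue_measure R) f :
  {measure set (measurableTypeR R) -> \bar R}); first exact: mf.
suff -> : lebesgue_measure X = mscale (NngNum tge0) m X.
  by rewrite /mscale/= muleA -EFinM mulVf ?mul1e// gt_eqF.
apply: lebesgue_measure_unique => //= _ [[a b]] _ <-.
rewrite /mscale/= /m /pushforward /f /=.
have -> : ( *%R t : R -> R) @^-1` `]a, b] = `](t^-1 * a), (t^-1 * b)]%classic.
  apply/seteqP; split => x /=; rewrite !in_itv/=.
    by rewrite ltr_pdivrMl// ler_pdivlMl.
  by rewrite ltr_pdivrMl// ler_pdivlMl.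
rewrite !lebesgue_measure_itv/= !lte_fin ltr_pM2l ?invr_gt0//.
case: ifPn => _; last by rewrite mule0.
by rewrite -!EFinB -EFinM -mulrBr mulrA divff ?mul1r// gt_eqF.
Qed.

Lemma dilate_measurable t : measurable_fun [set: plane] (dilate t).
Proof.
apply: measurable_fun_pair; apply: measurableT_comp => //.
all: exact: mulrl_measurable.
Qed.

Lemma dilateK t : 0 < t -> cancel (dilate t) (dilate t^-1).
Proof.
by move=> t0 [x y]; rewrite /dilate/= !mulKf// gt_eqF.
Qed.

Lemma dilateVK t : 0 < t -> cancel (dilate t^-1) (dilate t).
Proof.
by move=> t0 [x y]; rewrite /dilate/= !mulVKf// gt_eqF.
Qed.

(** Both the sections of [A] and the integral over the sections scale like
    lengths. *)
Lemma leb2_scale t A : 0 < t -> measurable A ->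
  (leb2 (dilate t @^-1` A) = (t^-1 ^+ 2)%:E * leb2 A)%E.
Proof.
move=> t0 mA; have tV0 : 0 < t^-1 by rewrite invr_gt0.
rewrite /leb2 /product_measure1.
have E x : x \in [set: measurableTypeR R] ->
   ((@lebesgue_measure R \o xsection (dilate t @^-1` A)) x =
    (t^-1)%:E * (@lebesgue_measure R \o xsection A) (t * x)%R)%E.
  by move=> _ /=; rewrite -lebesgue_measure_scale//; exact: measurable_xsection.
rewrite (eq_integral _ _ E).
have := @integral_comp_bij _ _ _ (@lebesgue_measure R)
  ( *%R t : R -> R) ( *%R t^-1 : R -> R) t^-1 t^-1 setT
  (@lebesgue_measure R \o xsection A).
rewrite preimage_setT -expr2; apply => //.
- by move=> x; rewrite mulKf// gt_eqF.
- by move=> x; rewrite mulVKf// gt_eqF.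
- by move=> X mX; exact: lebesgue_measure_scale.
Qed.

Lemma dilate_image t A : 0 < t -> dilate t @` A = dilate t^-1 @^-1` A.
Proof.
move=> t0; apply/seteqP; split => [_ [x Ax <-]|x Ax] /=.
  by rewrite dilateK.
by exists (dilate t^-1 x) => //; rewrite dilateVK.
Qed.

(** There are two versions because the two integrals see different structures
    on the plane: [Rintegral] takes a bundled measure and reads [leb2] over
    [measurableTypeR R * measurableTypeR R], the extended-real integral over the
    canonical structure of [R * R].  The sigma-algebras are the same, but not
    the displays. *)
Lemma integral_dilate t c A (f : plane -> \bar R) : 0 < t -> 0 < c ->
  (\int[@leb2 R]_(x in A) (c%:E * f (dilate t x)) =
   (c * t^-1 ^+ 2)%:E * \int[@leb2 R]_(x in dilate t @` A) f x)%E.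
Proof.
move=> t0 c0.
pose mu : {measure set plane -> \bar R} := HB.pack (@leb2 R)
  (isMeasure.Build _ plane R (@leb2 R)
    (@measure0 _ _ _ (@lebesgue_measure R \x @lebesgue_measure R)%E)
    (@measure_ge0 _ _ _ (@lebesgue_measure R \x @lebesgue_measure R)%E)
    (@measure_semi_sigma_additive _ _ _
      (@lebesgue_measure R \x @lebesgue_measure R)%E)).
rewrite [in LHS](_ : A = dilate t @^-1` (dilate t @` A)); last first.
  by rewrite dilate_image//; apply/seteqP; split => x /=; rewrite dilateK.
apply: (@integral_comp_bij _ _ _ mu _ (dilate t^-1)) => //.
- exact: dilate_measurable.
- exact: dilate_measurable.
- exact: dilateK.
- exact: dilateVK.
- by rewrite exprn_gt0// invr_gt0.
- by move=> B mB; exact: leb2_scale.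
Qed.

Lemma Rintegral_dilate t c A (f : plane -> R) : 0 < t -> 0 < c ->
  \int[@leb2 R]_(x in A) (c * f (dilate t x)) =
   (c * t^-1 ^+ 2) * \int[@leb2 R]_(x in dilate t @` A) f x.
Proof.
move=> t0 c0; rewrite /Rintegral.
rewrite [in LHS](_ : A = dilate t @^-1` (dilate t @` A)); last first.
  by rewrite dilate_image//; apply/seteqP; split => x /=; rewrite dilateK.
under eq_integral do rewrite EFinM.
have k0 : 0 < c * t^-1 ^+ 2 by rewrite mulr_gt0// exprn_gt0// invr_gt0.
rewrite (@integral_comp_bij _ _ _ (@lebesgue_measure R \x @lebesgue_measure R)%E
  (dilate t) (dilate t^-1) (t^-1 ^+ 2) c (dilate t @` A) (EFin \o f))//.
- by case: integral => [x| |]//; rewrite ?gt0_muley ?gt0_muleNy ?lte_fin//= mulr0.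
- exact: dilate_measurable.
- exact: dilate_measurable.
- exact: dilateK.
- exact: dilateVK.
- by rewrite exprn_gt0// invr_gt0.
- by move=> B mB; exact: leb2_scale.
Qed.

End Dilations.

(** * Topology of the plane and dilations *)

Section PlaneTopology.
Variable R : realType.
Local Notation plane := (R * R)%type.
Implicit Types (t : R) (A U : set plane).

(** Squares with rational centre and radius [1 / n] form a countable base. *)
Lemma plane_open_measurable U : open U -> measurable U.
Proof.
move=> oU.
pose B (q : rat * rat * nat) : set plane :=
  ball (ratr q.1.1 : R) (q.2.+1%:R^-1) `*` ball (ratr q.1.2 : R) (q.2.+1%:R^-1).
have -> : U = \bigcup_q (if `[< B q `<=` U >] then B q else set0).
  apply/seteqP; split => [x Ux|x [q _]]; last first.
    by case: asboolP => // + Bqx; apply.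
  have /nbhs_ballP[e /= e0 xeU] : nbhs x U by exact: open_nbhs_nbhs.
  have [n ne] : exists n : nat, n.+1%:R^-1 < e / 2 :> R.
    have e20 : 0 < e / 2 by rewrite divr_gt0.
    exists (Num.truncn (e / 2)^-1).
    by rewrite -[ltRHS]invrK ltf_pV2 ?posrE ?invr_gt0// truncnS_gt.
  pose d : R := n.+1%:R^-1.
  have d0 : 0 < d by rewrite invr_gt0.
  have near_rat (y : R) : exists q : rat, ball y d (ratr q).
    have [q] : exists q, ratr q \in `](y - d), (y + d)[.
      by apply: rat_in_itvoo; rewrite ltrBlDr -addrA ltrDl addr_gt0.
    rewrite in_itv/= => /andP[h1 h2]; exists q.
    by rewrite /ball/= ltr_distlC h1 h2.
  have [q1 xq1] := near_rat x.1; have [q2 xq2] := near_rat x.2.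
  exists (q1, q2, n) => //; case: asboolP => [_|notsub].
    by split; apply: ball_sym.
  exfalso; apply: notsub => y [/= y1 y2]; apply: xeU; rewrite (splitr e).
  have dle := le_ball (ltW ne).
  split.
    exact: ball_triangle (dle _ _ _ xq1) (dle _ _ _ y1).
  exact: ball_triangle (dle _ _ _ xq2) (dle _ _ _ y2).
apply: countable_bigcupT_measurable => // q; case: ifPn => // _.
by apply: measurableX; apply: open_measurable; exact: ball_open.
Qed.

Lemma dilate_continuous t : continuous (dilate t : plane -> plane).
Proof.
have -> : dilate t = (fun x : plane => t *: x) by apply/funext => -[].
exact: scaler_continuous.
Qed.

Lemma dilate_comp (s t : R) (x : plane) :
  dilate s (dilate t x) = dilate (s * t) x.
Proof. by rewrite /dilate/= !mulrA. Qed.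

Lemma dilate1 (x : plane) : dilate 1 x = x.
Proof. by case: x => x y; rewrite /dilate/= !mul1r. Qed.

Lemma dilate_image_comp (s t : R) A :
  dilate s @` (dilate t @` A) = dilate (s * t) @` A.
Proof. by rewrite image_comp; apply: eq_imagel => x _ /=; rewrite dilate_comp. Qed.

Lemma dilate_open (t : R) A : 0 < t -> open A -> open (dilate t @` A).
Proof.
move=> t0 oA; rewrite dilate_image//.
by apply: open_comp => // x _; exact: dilate_continuous.
Qed.

Lemma dilate_closure (t : R) A : dilate t @` closure A `<=` closure (dilate t @` A).
Proof.
move=> _ [x Ax <-] B nB.
have [y [Ay By]] := Ax _ (dilate_continuous nB).
by exists (dilate t y); split => //; exists y.
Qed.

End PlaneTopology.

(** * Sobolev seminorms under dilations *)

Section WeakDerivatives.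
Variable R : realType.
Local Notation plane := (R * R)%type.
Implicit Types (t c : R) (w : set plane) (u g f : plane -> R).

(** [smooth] and [partial] are both instances of this iteration. *)
Definition iter_derive (s : seq plane) f : plane -> R :=
  foldr (fun v h => 'D_v h) f s.

Lemma partialE a b f :
  partial a b f = iter_derive (nseq a (1, 0) ++ nseq b (0, 1)) f.
Proof.
rewrite /partial /iter_derive foldr_cat.
have iterE n v h : iter n (fun f : plane -> R => 'D_v f) h =
    foldr (fun v (h : plane -> R) => 'D_v h) h (nseq n v).
  by elim: n => //= n ->.
by rewrite !iterE.
Qed.

Lemma differentiable_dilate t c f x : differentiable f (dilate t x) ->
  differentiable (fun y => c * f (dilate t y)) x.
Proof.
move=> df; have -> : (fun y => c * f (dilate t y)) = c \*: (f \o (t \*: id)).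
  by apply/funext => -[].
by apply: differentiableZ; apply: differentiable_comp => //; case: x df.
Qed.

Lemma derive_dilate t c f v x : differentiable f (dilate t x) ->
  'D_v (fun y => c * f (dilate t y)) x = (c * t) * 'D_v f (dilate t x).
Proof.
move=> df; rewrite deriveE; last exact: differentiable_dilate.
rewrite (deriveE _ df).
pose S : plane -> plane := *:%R t.
have xE : S x = dilate t x by case: x {df}.
have -> : (fun y => c * f (dilate t y)) = c \*: (f \o S).
  by apply/funext => -[].
have diffS : is_diff x S S by exact: is_diff_scaler.
have dS : differentiable S x by [].
have df' : differentiable f (S x) by rewrite xE.
have dfS : differentiable (f \o S) x by exact: differentiable_comp.
transitivity (c * 'd (f \o S) x v).
  exact: (congr1 (fun h : plane -> R => h v) (diffZ c dfS)).
transitivity (c * 'd f (S x) ('d S x v)).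
  congr (c * _).
  exact: (congr1 (fun h : plane -> R => h v) (diff_comp dS df')).
have -> : 'd S x v = t *: v.
  have E : ('d S x : plane -> plane) = S by exact: diff_val.
  exact: (congr1 (fun h : plane -> plane => h v) E).
rewrite -mulrA; congr (c * _).
transitivity (t * 'd f (S x) v); last by rewrite xE.
exact: (linearZ_LR ('d f (S x)) t v).
Qed.

Lemma iter_derive_dilate t f s : smooth f ->
  iter_derive s (f \o dilate t) =
  (fun x => t ^+ size s * iter_derive s f (dilate t x)).
Proof.
move=> sf; elim: s => [|v s IHs] /=; apply/funext => x.
  by rewrite expr0 mul1r.
by rewrite IHs derive_dilate ?exprSr//; exact: (sf s).
Qed.

Lemma smooth_dilate t f : smooth f -> smooth (f \o dilate t).
Proof.
move=> sf s /= x; have /= := iter_derive_dilate t s sf; rewrite /iter_derive => ->.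
by apply: differentiable_dilate; exact: sf.
Qed.

Lemma test_function_dilate t w psi : 0 < t ->
  test_function w psi -> test_function (dilate t @` w) (psi \o dilate t^-1).
Proof.
move=> t0 [spsi [K [cK Kw psi0]]]; split; first exact: smooth_dilate.
exists (dilate t @` K); split.
- apply: continuous_compact => //; apply: continuous_subspaceT.
  exact: dilate_continuous.
- exact: image_subset.
- move=> x nKx /=; apply: psi0 => Kx; apply: nKx.
  by rewrite dilate_image.
Qed.

Lemma measurable_fun_dilate t c w u : 0 < t ->
  measurable_fun (dilate t @` w) u ->
  measurable_fun w (fun x => c * u (dilate t x)).
Proof.
move=> t0 mu mw.
(* The measurability of [w] is a premise inside [measurable_fun]; it gives that
   of the image. *)
suff : measurable_fun w (fun x => c * u (dilate t x)) by apply.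
have mtw : measurable (dilate t @` w).
  rewrite dilate_image// -[X in measurable X]setTI.
  exact: dilate_measurable.
apply: (@measurableT_comp _ _ _ _ _ _ ( *%R c)).
  exact: mulrl_measurable.
apply: (measurable_comp mtw) => //.
by apply: measurable_funS (@dilate_measurable _ t).
Qed.

Lemma loc_integrable_dilate t c w u : 0 < t -> 0 < c ->
  loc_integrable (dilate t @` w) u ->
  loc_integrable w (fun x => c * u (dilate t x)).
Proof.
move=> t0 c0 [mu iu]; split; first exact: measurable_fun_dilate.
move=> K Kw cK.
have /integrableP[mK iK] : (@leb2 R).-integrable (dilate t @` K) (EFin \o u).
  apply: iu; first exact: image_subset.
  apply: continuous_compact => //; apply: continuous_subspaceT.
  exact: dilate_continuous.
apply/integrableP; split.
  apply/measurable_EFinP; apply: measurable_fun_dilate => //.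
  exact/measurable_EFinP.
rewrite (_ : (fun x => `|(EFin \o (fun y => c * u (dilate t y))%R) x|%E) =
    (fun x => c%:E * (fun y => `|(u y)%:E|) (dilate t x))%E); last first.
  by apply/funext => x /=; rewrite normrM (gtr0_norm c0) EFinM.
rewrite (integral_dilate K (fun y => `|(u y)%:E|%E) t0 c0).
by rewrite lte_mul_pinfty// lee_fin mulr_ge0 ?exprn_ge0 ?invr_ge0 ?ltW.
Qed.

(** Test [u] against the test function rescaled to [dilate t @` w] and change
    variables.  The constants pulled out of the integrals are positive, so this
    needs no integrability. *)
Lemma weak_derivative_dilate t c w a b u g : 0 < t -> 0 < c ->
  is_weak_derivative (dilate t @` w) a b u g ->
  is_weak_derivative w a b (fun x => c * u (dilate t x))
    (fun x => c * t ^+ (a + b) * g (dilate t x)).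
Proof.
move=> t0 c0 [lu lg ug]; have ctab0 : 0 < c * t ^+ (a + b).
  by rewrite mulr_gt0// exprn_gt0.
split; [exact: loc_integrable_dilate | exact: loc_integrable_dilate |].
move=> psi tpsi; have := ug _ (test_function_dilate t0 tpsi).
have tV0 : 0 < t^-1 by rewrite invr_gt0.
have pE x : partial a b (psi \o dilate t^-1) x =
    t ^- (a + b) * partial a b psi (dilate t^-1 x).
  rewrite !partialE iter_derive_dilate; last by case: tpsi.
  by rewrite size_cat !size_nseq exprVn.
have L : \int[@leb2 R]_(x in w) (c * u (dilate t x) * partial a b psi x) =
   c * t ^+ (a + b) * t^-1 ^+ 2 *
   \int[@leb2 R]_(x in dilate t @` w) (u x * partial a b (psi \o dilate t^-1) x).
  rewrite -(Rintegral_dilate w (fun x => _ * _) t0 ctab0).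
  apply: eq_Rintegral => x _; rewrite pE dilateK//.
  rewrite -!mulrA; congr (_ * _); rewrite mulrCA; congr (_ * _).
  by rewrite mulrA divff ?mul1r// gt_eqF// exprn_gt0.
have RR : \int[@leb2 R]_(x in w) (c * t ^+ (a + b) * g (dilate t x) * psi x) =
   c * t ^+ (a + b) * t^-1 ^+ 2 *
   \int[@leb2 R]_(x in dilate t @` w) (g x * (psi \o dilate t^-1) x).
  rewrite -(Rintegral_dilate w (fun x => _ * _) t0 ctab0).
  by apply: eq_Rintegral => x _ /=; rewrite dilateK// !mulrA.
by move=> E; apply: (etrans L); rewrite E mulrCA; congr (_ * _); exact: esym.
Qed.

(** Recorded only here: the real-valued integrals above must elaborate [leb2] as
    a product measure, as they do in the definition of weak derivatives. *)
HB.instance Definition _ := isMeasure.Build _ plane R (@leb2 R)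
  (@measure0 _ _ _ (@lebesgue_measure R \x @lebesgue_measure R)%E)
  (@measure_ge0 _ _ _ (@lebesgue_measure R \x @lebesgue_measure R)%E)
  (@measure_semi_sigma_additive _ _ _
    (@lebesgue_measure R \x @lebesgue_measure R)%E).

Lemma L2_dilate t c w u : 0 < t -> 0 < c ->
  L2 (dilate t @` w) u -> L2 w (fun x => c * u (dilate t x)).
Proof.
move=> t0 c0 [mu iu]; split; first exact: measurable_fun_dilate.
under eq_integral do rewrite exprMn EFinM.
rewrite (integral_dilate w (fun y => (u y ^+ 2)%:E)) ?exprn_gt0//.
by rewrite lte_mul_pinfty// lee_fin mulr_ge0 ?exprn_ge0 ?invr_ge0 ?ltW.
Qed.

Lemma L2S w w' u : measurable w -> measurable w' -> w `<=` w' ->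
  L2 w' u -> L2 w u.
Proof.
move=> mw mw' ww' [mu iu]; split; first exact: measurable_funS mu.
apply: le_lt_trans iu; apply: ge0_subset_integral => //.
  apply/measurable_EFinP.
  exact: measurable_funX.
by move=> x _; rewrite lee_fin sqr_ge0.
Qed.

Lemma weak_derivative_sq_ge0 w a b u : (0 <= weak_derivative_sq w a b u)%E.
Proof.
apply: le_ereal_inf_tmp => _ [g _ <-]; apply: integral_ge0 => x _.
by rewrite lee_fin sqr_ge0.
Qed.

Lemma Hseminorm_sq_ge0 r w u : (0 <= Hseminorm_sq r w u)%E.
Proof. by apply: sume_ge0 => a _; exact: weak_derivative_sq_ge0. Qed.

(** Only the inequality that bounds the seminorm on the large scale from below
    is of use; it follows since rescaling sends weak derivatives of [u] to weak
    derivatives of the rescaled function. *)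
Lemma weak_derivative_sq_dilate t c w a b u : 0 < t -> 0 < c ->
  ((t ^+ 2 / (c * t ^+ (a + b)) ^+ 2)%:E *
     weak_derivative_sq w a b (fun x => c * u (dilate t x))%R <=
   weak_derivative_sq (dilate t @` w) a b u)%E.
Proof.
move=> t0 c0; apply: le_ereal_inf_tmp => _ [g wg <-].
have ct0 : 0 < c * t ^+ (a + b) by rewrite mulr_gt0// exprn_gt0.
rewrite -lee_pdivlMl; last by rewrite divr_gt0// exprn_gt0.
apply: ereal_inf_lbound.
exists (fun x => c * t ^+ (a + b) * g (dilate t x)).
  exact: weak_derivative_dilate.
under eq_integral do rewrite exprMn EFinM.
rewrite (integral_dilate w (fun y => (g y ^+ 2)%:E)) ?exprn_gt0//.
by rewrite invf_div exprVn.
Qed.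

Lemma Hseminorm_sq_dilate t c w r u : 0 < t -> 0 < c ->
  ((t ^+ 2 / (c * t ^+ r) ^+ 2)%:E *
     Hseminorm_sq r w (fun x => c * u (dilate t x))%R <=
   Hseminorm_sq r (dilate t @` w) u)%E.
Proof.
move=> t0 c0; rewrite /Hseminorm_sq ge0_sume_distrr; last first.
  move=> a _; exact: weak_derivative_sq_ge0.
apply: lee_sum => a _.
have ar : (a + (r - a))%N = r by rewrite subnKC// -ltnS.
by rewrite -{1}ar; exact: weak_derivative_sq_dilate.
Qed.

End WeakDerivatives.

(** * Self-similarity of the domain, the meshes and the discrete spaces *)

Section Shift.
Variables (R : realType) (D : ringDomain R) (p r : nat).
Local Notation plane := (R * R)%type.
Local Notation lam := (rd_lambda D).
Local Notation N := (rd_N D).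
Implicit Types (A w : set plane) (u phi : plane -> R).

Lemma lam_gt0 : 0 < lam. Proof. by case/andP: (rd_lambda01 D). Qed.

(** [lam Omega] is the interior of the closed set [closure Y], and it is
    contained in the closure of [Omega].  Dilating the latter inclusion puts the
    open set [lam (lam Omega)] into [closure (lam Omega)], hence into
    [closure Y] and then into its interior [lam Omega]; undo the dilation. *)
Lemma dilate_lam_Omega : dilate lam @` rd_Omega D `<=` rd_Omega D.
Proof.
have lam0 := lam_gt0.
set Y := \bigcup_(i in [set i | (1 <= i)%N]) closure (rd_ring D i).
have YE : interior (closure Y) = dilate lam @` rd_Omega D.
  by rewrite -[X in dilate X]expr1 -rd_cap.
have sub_cl : dilate lam @` rd_Omega D `<=` closure (rd_Omega D).
  rewrite -YE rd_cover; apply: subset_trans (@interior_subset _ _) _.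
  by apply: closure_subset; apply: bigcup_subset.
have sub2 : dilate lam @` (dilate lam @` rd_Omega D) `<=` dilate lam @` rd_Omega D.
  rewrite -[X in _ `<=` X]YE -open_subsetE; last first.
    by do 2 apply: dilate_open => //; exact: rd_Omega_open.
  apply: subset_trans (image_subset _ sub_cl) _.
  apply: subset_trans (@dilate_closure _ _ _) _; rewrite -YE.
  apply: subset_trans (closure_subset (@interior_subset _ _)) _.
  by rewrite -(iffLR (closure_id _) (@closed_closure _ Y)).
move=> x Ox; have [|y Oy] := sub2 (dilate lam x); first by exists x.
by move=> /(can_inj (dilateK lam0)) <-.
Qed.

Lemma dilate_lamX_Omega i : dilate (lam ^+ i) @` rd_Omega D `<=` rd_Omega D.
Proof.
elim: i => [_ [x Ox <-]|i IHi]; first by rewrite expr0 dilate1.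
rewrite exprS -dilate_image_comp; apply: subset_trans dilate_lam_Omega.
exact: image_subset.
Qed.

Lemma ring_scaledX i : rd_ring D i = dilate (lam ^+ i) @` rd_ring D 0.
Proof.
elim: i => [|i IHi].
  by apply/seteqP; split => [x|_ [x + <-]]; [exists x => //|]; rewrite expr0 dilate1.
by rewrite rd_ring_scaled IHi dilate_image_comp exprS.
Qed.

Lemma rd_G_shift i j (n : 'I_N) x :
  rd_G (i + j) n x = dilate (lam ^+ j) (rd_G i n x).
Proof. by rewrite rd_G_scaled [in RHS]rd_G_scaled dilate_comp -exprD addnC. Qed.

(** Action on the elements of the dilation by [lam ^+ j]. *)
Definition shift_element (j : nat) (e : element D) : element D :=
  match e with
  | Cell i n k j1 j2 => Cell (i + j) n k j1 j2
  | Cap l => Cap D (l + j)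
  end.

Lemma element_dom_shift j e :
  element_dom (shift_element j e) = dilate (lam ^+ j) @` element_dom e.
Proof.
case: e => [i n k j1 j2|l] /=.
  by rewrite image_comp; apply: eq_imagel => x _ /=; rewrite rd_G_shift.
by rewrite /cap dilate_image_comp -exprD addnC addnS.
Qed.

Lemma mesh_ring_shift k j :
  mesh_ring D (k + j) j = [seq shift_element j e | e <- mesh_ring D k 0].
Proof.
rewrite /mesh_ring map_flatten -map_comp; congr flatten; apply: eq_map => n /=.
by rewrite /mesh_patch addnK subn0 map_allpairs.
Qed.

Variable capS : nat -> set (plane -> R).
Hypothesis capS_fin : forall l, finite_dim_space (cap D l) (capS l).
Hypothesis capS_scaled : cap_spaces_scaled D capS.

(** On cells the parameterizations absorb the dilation; on caps the spaces are
    scaled copies of each other, and a span is stable under scalars. *)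
Lemma element_space_shift c j e u :
  element_space p capS (shift_element j e) u ->
  element_space p capS e (fun x => c * u (dilate (lam ^+ j) x)).
Proof.
have lam0 := lam_gt0; case: e => [i n k j1 j2|l] /=.
  move=> [f [q fq] uf]; exists (fun x => c * f x); last first.
    by move=> x sx; rewrite -rd_G_shift uf.
  exists (fun a b => c * q a b) => x; rewrite fq mulr_sumr.
  apply: eq_bigr => a _; rewrite mulr_sumr; apply: eq_bigr => b _.
  by rewrite !mulrA.
rewrite (capS_scaled (l + j)) (capS_scaled l) => -[psi psi0 upsi].
exists (fun x => c * psi x).
  have [m [e capE]] := capS_fin 0; rewrite capE in psi0 *.
  have [d psid] := psi0; exists (fun k => c * d k) => x wx.
  by rewrite psid// mulr_sumr; apply: eq_bigr => k _; rewrite mulrA.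
move=> x capx; rewrite upsi; last first.
  have -> : cap D (l + j) = dilate (lam ^+ j) @` cap D l.
    exact: (element_dom_shift j (Cap D l)).
  by exists x.
by rewrite dilate_comp exprD invfM mulrVK// unitfE expf_neq0// gt_eqF.
Qed.

Lemma discrete_space_shift c j (theta theta' : set plane)
    (Th Th' : seq (element D)) u :
  0 < c -> open theta -> open theta' ->
  dilate (lam ^+ j) @` theta' `<=` theta ->
  {subset map (shift_element j) Th' <= Th} ->
  discrete_space p capS theta Th u ->
  discrete_space p capS theta' Th' (fun x => c * u (dilate (lam ^+ j) x)).
Proof.
move=> c0 ot ot' tt' ThTh' [L2u Thu]; have lamj : 0 < lam ^+ j.
  by rewrite exprn_gt0// lam_gt0.
split.
  apply: L2_dilate => //; apply: L2S tt' L2u.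
    by apply: plane_open_measurable; exact: dilate_open.
  exact: plane_open_measurable.
move=> e eTh'; apply: element_space_shift; apply: Thu; apply: ThTh'.
exact: map_f.
Qed.

Lemma best_error_ge0 theta (Th : seq (element D)) u :
  (0 <= best_error p capS r theta Th u)%E.
Proof. by apply: le_ereal_inf_tmp => _ [v _ <-]; exact: sqrte_ge0. Qed.

Lemma Pmax_homogeneous k phi t x : Pmax k phi ->
  phi (dilate t x) = t ^+ k * phi x.
Proof.
move=> [d phiE]; rewrite !phiE mulr_sumr; apply: eq_bigr => i _ /=.
rewrite !exprMn -[in t ^+ k](subnK (ltn_ord i : (i <= k)%N)) exprD.
ring.
Qed.

(** Compare [u] with [v x = t^-(kappa0 + 1) u (t x)] for [t = lam^j].  Since
    [phi] is homogeneous of degree [kappa0 + 1], [phi - v] is the rescaling of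
    [phi - u] by the same factor, and [v] competes in the best error on
    [theta']. *)
Lemma best_error_shift kappa0 j (theta theta' : set plane)
    (Th Th' : seq (element D)) phi u :
  (r <= kappa0.+1)%N -> Pmax kappa0.+1 phi ->
  open theta -> open theta' ->
  dilate (lam ^+ j) @` theta' `<=` theta ->
  {subset map (shift_element j) Th' <= Th} ->
  discrete_space p capS theta Th u ->
  (((lam ^+ (kappa0 + 2 - r)) ^+ (2 * j))%:E *
     best_error p capS r theta' Th' phi ^+ 2 <=
   \sum_(e <- map (shift_element j) Th')
     Hseminorm_sq r (element_dom e) (phi \- u)%R)%E.
Proof.
move=> rk Pphi ot ot' tt' ThTh' uTh; set t := lam ^+ j.
have t0 : 0 < t by rewrite exprn_gt0// lam_gt0.
have c0 : 0 < t ^- kappa0.+1 by rewrite invr_gt0 exprn_gt0.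
pose v x := t ^- kappa0.+1 * u (dilate t x).
have vTh : discrete_space p capS theta' Th' v.
  exact: discrete_space_shift uTh.
have phivE : phi \- v = (fun x => t ^- kappa0.+1 * (phi \- u) (dilate t x)).
  apply/funext => x /=; rewrite mulrBr (Pmax_homogeneous _ _ Pphi).
  by rewrite mulKf// gt_eqF// exprn_gt0.
have factorE : (lam ^+ (kappa0 + 2 - r)) ^+ (2 * j) =
    t ^+ 2 / (t ^- kappa0.+1 * t ^+ r) ^+ 2.
  have -> : (lam ^+ (kappa0 + 2 - r)) ^+ (2 * j) =
      (t ^+ (kappa0 + 2 - r)) ^+ 2.
    by rewrite /t -!exprM; congr (_ ^+ _); ring.
  rewrite -expr_div_n; congr (_ ^+ 2).
  have tr0 : t ^+ r != 0 by rewrite expf_neq0// lt0r_neq0.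
  rewrite invfM invrK mulrA -exprS; apply: (mulIf tr0).
  rewrite divfK// -exprD subnK ?addn2//.
  exact: leq_trans rk _.
have sum_ge0 : (0 <= \sum_(e <- Th') Hseminorm_sq r (element_dom e) (phi \- v)%R)%E.
  by apply: sume_ge0 => e _; exact: Hseminorm_sq_ge0.
apply: (@le_trans _ _ ((t ^+ 2 / (t ^- kappa0.+1 * t ^+ r) ^+ 2)%:E *
    \sum_(e <- Th') Hseminorm_sq r (element_dom e) (phi \- v)%R)%E).
  rewrite factorE; apply: lee_wpmul2l.
    by rewrite lee_fin divr_ge0 ?sqr_ge0.
  rewrite -[leRHS]sqr_sqrte// !expe2; apply: lee_pmul; rewrite ?best_error_ge0//.
    by apply: ereal_inf_lbound; exists v.
  by apply: ereal_inf_lbound; exists v.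
rewrite ge0_sume_distrr; last by move=> e _; exact: Hseminorm_sq_ge0.
rewrite big_map; apply: lee_sum => e _; rewrite phivE element_dom_shift.
exact: Hseminorm_sq_dilate.
Qed.

End Shift.

(** * The lower bound *)

Lemma sqre_le (R : realType) (x y : \bar R) : (0 <= x)%E -> (x <= y)%E ->
  (x ^+ 2 <= y ^+ 2)%E.
Proof. by move=> x0 xy; rewrite !expe2 lee_pmul. Qed.

Lemma mesh_ring_sub_star (R : realType) (D : ringDomain R) (l i : nat) :
  (i <= l)%N -> {subset mesh_ring D l i <= mesh_star D l}.
Proof.
move=> il e eM; rewrite mem_rcons inE; apply/orP; right.
apply/flattenP; exists (mesh_ring D l i) => //; apply: map_f.
by rewrite mem_iota.
Qed.

(** Ring [l] is unrefined at level [l], so together with the cap it is a small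
    copy of the coarsest mesh of the whole domain. *)
Lemma mesh_star_split (R : realType) (D : ringDomain R) (l : nat) :
  mesh_star D l = flatten [seq mesh_ring D l i | i <- iota 0 l] ++
                  map (shift_element l) (mesh_star D 0).
Proof.
rewrite /mesh_star /mesh -[in iota 0 l.+1]addn1 iotaD map_cat flatten_cat /=.
rewrite !cats0 add0n map_rcons /= -rcons_cat; congr (rcons (_ ++ _) _).
by rewrite -mesh_ring_shift.
Qed.

Theorem theorem12 (R : realType) (D : ringDomain R) (p r kappa0 : nat)
    (capS : nat -> set (R * R -> R))
    (capS_fin : forall l, finite_dim_space (cap D l) (capS l))
    (capS_Hr : forall l, capS l `<=` [set u | Hspace r (cap D l) u])
    (capS_scaled : cap_spaces_scaled D capS)
    (hkappa0 : is_kappa0 D p capS kappa0)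
    (hcap : exists2 k, is_kappa p capS (Cap D 0) k & (kappa0 <= k)%N)
    (hr : (r <= kappa0.+1)%N)
    (phi : R * R -> R)
    (phi_max : Pmax kappa0.+1 phi)
    (phi_norm : Hnorm p.+1 (rd_Omega D) phi = 1%:E)
    (phi_attains : best_error p capS r (rd_Omega D) (mesh_star D 0) phi =
                   C0 D p capS kappa0 r)
    (c : R)
    (hc : forall l : nat,
      (c%:E * ((1 / 2 ^+ l) ^ (p.+1%:Z - r%:Z))%:E * C0 D p capS kappa0 r <=
       best_error p capS r (rd_ring D 0) (mesh_ring D l 0) phi)%E) :
  let A : R := rd_lambda D ^+ (kappa0 + 2 - r) in
  let B : R := 1 / 2 ^ (p.+1%:Z - r%:Z) in
  forall l : nat,
    ((Num.min 1 c)%:E * C0 D p capS kappa0 r *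
       (Num.sqrt (\sum_(i < l.+1) A ^+ (2 * i) * B ^+ (2 * (l - i))))%:E <=
     best_error p capS r (rd_Omega D) (mesh_star D l) phi)%E.
Proof.
move=> A B l.
set E0 := C0 D p capS kappa0 r in hc phi_attains *.
have E0_ge0 : (0 <= E0)%E by rewrite -phi_attains best_error_ge0.
have [c_le0|c_gt0] := leP c 0.
  apply: le_trans (best_error_ge0 _ _ _ _ _ _).
  apply: mule_le0_ge0; last by rewrite lee_fin sqrtr_ge0.
  by apply: mule_le0_ge0 => //; rewrite lee_fin ge_min c_le0 orbT.
set m := Num.min 1 c.
have m_gt0 : 0 < m by rewrite lt_min ltr01.
have lam0 := lam_gt0 D.
have A_gt0 : 0 < A by rewrite exprn_gt0.
have B_gt0 : 0 < B by rewrite divr_gt0// exprz_gt0.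
have hc' k : ((m * B ^+ k)%:E * E0 <=
    best_error p capS r (rd_ring D 0) (mesh_ring D k 0) phi)%E.
  have -> : B ^+ k = (1 / 2 ^+ k) ^ (p.+1%:Z - r%:Z).
    by rewrite /B !div1r exprz_inv invr_expz !exprnP !exprz_exp mulrC.
  apply: le_trans (hc k); rewrite -EFinM lee_wpmul2r// lee_fin.
  by rewrite ler_wpM2r ?exprz_ge0 ?divr_ge0 ?exprn_ge0// ge_min lexx orbT.
apply: le_ereal_inf_tmp => _ [u uTh <-]; rewrite /broken_seminorm.
set sigma := \sum_(i < l.+1) _.
have sigma_ge0 : 0 <= sigma.
  by apply: sumr_ge0 => i _; rewrite mulr_ge0 ?exprn_ge0 ?ltW.
have -> : (m%:E * E0 * (Num.sqrt sigma)%:E =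
    sqrte ((m ^+ 2 * sigma)%:E * E0 ^+ 2))%E.
  have m2sigma_ge0 : 0 <= m ^+ 2 * sigma by rewrite mulr_ge0 ?sqr_ge0.
  rewrite sqrteM ?lee_fin// sqrte_sqr gee0_abs//=.
  by rewrite sqrtrM ?sqr_ge0// sqrtr_sqr gtr0_norm// EFinM muleAC.
rewrite lee_sqrt; last by apply: sume_ge0 => e _; exact: Hseminorm_sq_ge0.
rewrite mesh_star_split big_cat big_flatten big_map /=.
have scaled_ring i : (i < l)%N ->
  ((m ^+ 2 * (A ^+ (2 * i) * B ^+ (2 * (l - i))))%:E * E0 ^+ 2 <=
   \sum_(e <- mesh_ring D l i) Hseminorm_sq r (element_dom e) (phi \- u)%R)%E.
  move=> il; have ringE := mesh_ring_shift D (l - i) i.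
  rewrite subnK ?(ltnW il)// in ringE; rewrite ringE.
  apply: le_trans (best_error_shift (kappa0 := kappa0) (j := i)
    capS_fin capS_scaled hr phi_max (@rd_Omega_open _ D)
    (@rd_ring_open _ D 0) _ _ uTh); last 2 first.
  - by rewrite -ring_scaledX; exact: rd_ring_sub.
  - by rewrite -ringE; apply: mesh_ring_sub_star; exact: ltnW.
  rewrite -/A mulrCA EFinM -muleA; apply: lee_wpmul2l.
    by rewrite lee_fin exprn_ge0// ltW.
  apply: le_trans (sqre_le _ (hc' (l - i)%N)).
    rewrite !expe2 muleACA -EFinM.
    suff -> : m * B ^+ (l - i) * (m * B ^+ (l - i)) =
        m ^+ 2 * B ^+ (2 * (l - i)).
      by [].
    by rewrite mulnC exprM; ring.
  by rewrite mule_ge0// lee_fin mulr_ge0 ?exprn_ge0// ltW.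
have scaled_cap : ((m ^+ 2 * (A ^+ (2 * l) * B ^+ (2 * (l - l))))%:E * E0 ^+ 2 <=
   \sum_(e <- map (shift_element l) (mesh_star D 0))
     Hseminorm_sq r (element_dom e) (phi \- u)%R)%E.
  apply: le_trans (best_error_shift (kappa0 := kappa0) (j := l)
    capS_fin capS_scaled hr phi_max (@rd_Omega_open _ D)
    (@rd_Omega_open _ D) _ _ uTh); last 2 first.
  - exact: dilate_lamX_Omega.
  - by move=> e eS; rewrite mesh_star_split mem_cat eS orbT.
  rewrite -/A phi_attains subnn muln0 expr0 mulr1.
  apply: lee_wpmul2r; first by rewrite expe2 mule_ge0.
  rewrite lee_fin; apply: ler_piMl; first by rewrite exprn_ge0// ltW.
  by apply: exprn_ile1; [exact: ltW | rewrite ge_min lexx].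
rewrite mulr_sumr -sumEFin ge0_sume_distrl; last first.
  by move=> i _; rewrite lee_fin !mulr_ge0 ?exprn_ge0 ?ltW.
rewrite big_ord_recr/=; apply: leeD; last exact: scaled_cap.
rewrite -(big_mkord xpredT (fun i =>
  (m ^+ 2 * (A ^+ (2 * i) * B ^+ (2 * (l - i))))%:E * E0 ^+ 2)%E).
rewrite /index_iota subn0 big_seq [leRHS]big_seq; apply: lee_sum => i.
by rewrite mem_iota => /andP[_ il]; exact: scaled_ring.
Qed.
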